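(* The integer group determinants of $GA(1,9)$ are exactly the integers of the form $$D=AB^{8},\qquad A,B\in\mathbb Z,$$ where either $A$ is odd or $2^5\mid A$, and $B\equiv A\pmod 9$.
   Context: For a finite group $G=\{g_1,\dots,g_n\}$ and an element $\sum_{g\in G}a_g g$ of the group ring $\mathbb Z[G]$ (all $a_g\in\mathbb Z$), the group determinant is $D\left(\sum_{g\in G}a_g g\right)=\det\left(a_{g_ig_j^{-1}}\right)_{i,j=1}^n$. An integer group determinant of $G$ is any integer of this form. The general affine group of degree one over $\mathbb F_9$ is $GA(1,9)=\left\{\begin{pmatrix} a & b\\ 0 & 1\end{pmatrix}: a\in\mathbb F_9^*,\ b\in\mathbb F_9\right\}$ under matrix multiplication (a group of order $72$). *)

(* Defs.v *)
From HB Require Import structures.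
From mathcomp Require Import all_boot all_order all_algebra all_fingroup all_field.
Set Implicit Arguments. Unset Strict Implicit. Unset Printing Implicit Defensive.
Import GRing.Theory Num.Theory.
Local Open Scope ring_scope.

Definition groupdet (gT : finGroupType) (G : {set gT}) (a : gT -> int) : int :=
  \det (\matrix_(i < #|G|, j < #|G|)
          a ((@enum_val _ (pred_of_set G) i) * (@enum_val _ (pred_of_set G) j)^-1)%g).

Definition GA1 (F : finFieldType) : {set {'GL_2[F]}} :=
  [set u : {'GL_2[F]} | ((GLval u) ord_max ord0 == 0) && ((GLval u) ord_max ord_max == 1)].

(* Main.v *)
(** The affine group is [F ><| F^*], with [F^*] cyclic of order 8.  After the
    substitution [b = u b'], its group matrix consists of 8 x 8 blocks which are
    convolution operators on [F], so the Fourier transform over the 9 additive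
    characters of [F] splits it.  The trivial character gives the circulant of
    the pushforward to [C_8], of determinant [A]; the 8 others are permuted by
    dilations and all give the same determinant [B].  Expanding the determinant
    over the group ring of [F], these are [A = sum_x c x] and
    [B = sum_x c x psi(-x)] with [c] integer valued, and Fourier inversion at 1
    gives [A - B = 9 c(1)].  For the circulants of order 8, factoring the
    determinant along [x^8 - 1 = (x-1)(x+1)(x^2+1)(x^4+1)] shows that all the
    factors have the same parity, and a mod 4 discussion gives [2^5].

    Conversely, let [f] in [Z[C_8]] have determinant [A != 0] and adjugate [g],
    with coprime coefficients.  Adding to [f] an integral combination, of total
    weight 0, of the elements [t_1 S t_{-y}], where [S] is the sum of the
    subgroup [C_8] and [t_y] the translation by [y], changes nothing at the
    trivial character and perturbs the other block by a rank one matrix, so that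
    [B] becomes [A + 9 k] where [k] is any combination of the coefficients of
    [g]. *)

Require Import Defs.
From HB Require Import structures.
From mathcomp Require Import all_boot all_order all_algebra all_fingroup all_field.
From mathcomp Require Import all_character ring zify.
Import GRing.Theory Num.Theory.
Local Open Scope ring_scope.
Set Implicit Arguments. Unset Strict Implicit. Unset Printing Implicit Defensive.

(** * Determinants indexed by finite types *)

(** Two enumerations differ by a permutation, which acts on rows and columns at once, so its sign is
    squared. *)
Lemma det_reindex (R : comNzRingType) (T : finType) m n (h : 'I_m -> T)
    (k : 'I_n -> T) (M : T -> T -> R) :
  bijective h -> bijective k ->
  \det (\matrix_(i, j) M (h i) (h j)) = \det (\matrix_(i, j) M (k i) (k j)).
Proof.
move=> bij_h [k' k'K kK'].
have bij_kh: bijective (k' \o h) by apply: bij_comp => //; exists k.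
have eq_mn: m = n by have /= := bij_eq_card bij_kh; rewrite !card_ord.
case: n / eq_mn in k k' k'K kK' bij_kh *.
pose s := perm (bij_inj bij_kh).
have hE i : h i = k (s i) by rewrite permE /= kK'.
pose N := \matrix_(i, j) M (k i) (k j).
transitivity (\det (row_perm s (col_perm s N))).
  by congr (\det _); apply/matrixP=> i j; rewrite !mxE !hE.
by rewrite row_permE col_permE !det_mulmx !det_perm odd_permV mulrCA -expr2 sqrr_sign mulr1.
Qed.

Definition fdet (R : comNzRingType) (T : finType) (M : T -> T -> R) :=
  \det (\matrix_(i < #|T|, j < #|T|) M (enum_val i) (enum_val j)).

Lemma fdetE (R : comNzRingType) (T : finType) n (h : 'I_n -> T) (M : T -> T -> R) :
  bijective h -> fdet M = \det (\matrix_(i, j) M (h i) (h j)).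
Proof. by move=> bij_h; apply: det_reindex => //; apply: enum_val_bij. Qed.

Lemma fdet_ord (R : comNzRingType) n (M : 'I_n -> 'I_n -> R) :
  fdet M = \det (\matrix_(i, j) M i j).
Proof. by rewrite (@fdetE _ _ n id) //; exists id. Qed.

Lemma eq_fdet (R : comNzRingType) (T : finType) (M N : T -> T -> R) :
  M =2 N -> fdet M = fdet N.
Proof. by move=> eqMN; congr (\det _); apply/matrixP=> i j; rewrite !mxE eqMN. Qed.

Lemma fdet_reindex (R : comNzRingType) (S T : finType) (h : S -> T) (M : T -> T -> R) :
  bijective h -> fdet (fun x y => M (h x) (h y)) = fdet M.
Proof.
move=> bij_h; have bij_hE: bijective (h \o @enum_val S S) by apply: bij_comp => //; apply: enum_val_bij.
by rewrite (fdetE _ bij_hE).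
Qed.

Lemma fdetM (R : comNzRingType) (T : finType) (M N : T -> T -> R) :
  fdet (fun x y => \sum_z M x z * N z y) = fdet M * fdet N.
Proof.
rewrite -det_mulmx; congr (\det _); apply/matrixP=> i j; rewrite !mxE.
rewrite (reindex (@enum_val T T)) /=; last exact/onW_bij/enum_val_bij.
by apply: eq_bigr => k _; rewrite !mxE.
Qed.

Lemma fdet_sum (R : comNzRingType) (S T : finType) (M : S + T -> S + T -> R) :
    (forall x y, M (inl x) (inr y) = 0) ->
  fdet M = fdet (fun x y => M (inl x) (inl y))
             * fdet (fun x y => M (inr x) (inr y)).
Proof.
move=> M0; pose h (i : 'I_(#|S| + #|T|)) : S + T :=
  match split i with inl j => inl (enum_val j) | inr j => inr (enum_val j) end.
have bij_h: bijective h.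
  exists (fun x => unsplit (match x with inl s => inl (enum_rank s)
                            | inr t => inr (enum_rank t) end)).
  - move=> i; rewrite -[RHS](splitK i) /h; congr (unsplit _).
    by case: (split i) => j; rewrite enum_valK.
  - by case=> x; rewrite /h unsplitK enum_rankK.
rewrite (fdetE _ bij_h) -(det_lblock _ (\matrix_(i, j) M (inr (enum_val i)) (inl (enum_val j)))).
congr (\det _); apply/matrixP=> i j; rewrite !mxE /h.
by case: (split i) => i'; rewrite !mxE; case: (split j) => j'; rewrite !mxE.
Qed.

Lemma fdet_diag_ord (R : comNzRingType) (T : finType) n (N : 'I_n -> T -> T -> R) :
  @fdet R (T * 'I_n)%type (fun x y => (x.2 == y.2)%:R * N x.2 x.1 y.1)
    = \prod_k fdet (N k).
Proof.
elim: n N => [|n IHn] N.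
  rewrite big_ord0 /fdet; have: #|{: T * 'I_0}| = 0%N by rewrite card_prod card_ord muln0.
  (* The cardinal occurs in the type of [enum_val], which is generalized before the cardinal becomes
     0. *)
  by move: (enum_val) => f E; move: f; rewrite E => f; rewrite det_mx00.
pose h (x : T + T * 'I_n) : T * 'I_n.+1 :=
  match x with inl t => (t, ord0) | inr (t, i) => (t, lift ord0 i) end.
have bij_h: bijective h.
  exists (fun x => if unlift ord0 x.2 is Some i then inr (x.1, i) else inl x.1).
  - by case=> [t|[t i]]; rewrite /h /= ?unlift_none ?liftK.
  - by case=> t i /=; case: unliftP => [j ->|->].
rewrite big_ord_recl -(fdet_reindex _ bij_h) fdet_sum; last first.
  by move=> x [y i]; rewrite mul0r.
congr (_ * _); first by apply: eq_fdet => x y; rewrite mul1r.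
rewrite -IHn; apply: eq_fdet => -[x i] [y j] /=.
by rewrite (inj_eq lift_inj).
Qed.

Lemma fdet_diag (R : comNzRingType) (T K : finType) (N : K -> T -> T -> R) :
  @fdet R (T * K)%type (fun x y => (x.2 == y.2)%:R * N x.2 x.1 y.1) = \prod_k fdet (N k).
Proof.
pose h (x : T * 'I_#|K|) : T * K := (x.1, enum_val x.2).
have bij_h: bijective h.
  exists (fun x => (x.1, enum_rank x.2)) => [[x i]|[x k]];
  by rewrite /h /= ?enum_valK ?enum_rankK.
rewrite -(fdet_reindex _ bij_h) (reindex (@enum_val K K)); last exact/onW_bij/enum_val_bij.
rewrite -(fdet_diag_ord (fun i : 'I_#|K| => N (enum_val i))); apply: eq_fdet => x y.
by rewrite /h /= (inj_eq enum_val_inj).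
Qed.

(** Since [(C + u v) G = d + u w] with [w = v G], it suffices to find [\det (d + u w)]. It is the
    determinant of the block matrix [A], and clearing the lower left corner of [A] instead gives
    [d * \det A = (d + w u) d^n]. *)
Lemma det_add_rank1 (R : idomainType) n (C G : 'M[R]_n) (u : 'cV_n) (v : 'rV_n) (d : R) :
    C *m G = d%:M -> \det C = d -> d != 0 ->
  \det (C + u *m v) = d + (v *m G *m u) 0 0.
Proof.
move=> CG dC d0; set w := v *m G.
have dG: d * \det G = d ^+ n by rewrite -{1}dC -det_mulmx CG det_scalar.
have key: d * \det (d%:M + u *m w) = (d + (w *m u) 0 0) * d ^+ n.
  pose A := block_mx (1%:M : 'M_1) (- w) u (d%:M : 'M_n).
  have <-: \det A = \det (d%:M + u *m w).
    have E: A *m block_mx 1%:M w 0 1%:M = block_mx 1%:M 0 u (d%:M + u *m w).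
      by rewrite mulmx_block !mulmx1 !mul1mx !mulmx0 !addr0 subrr [u *m w + _]addrC.
    by have := congr1 determinant E; rewrite det_mulmx det_ublock det_lblock !det1 !mulr1 mul1r.
  have E: A *m block_mx d%:M 0 (- u) 1%:M = block_mx (d%:M + w *m u) (- w) 0 d%:M.
    rewrite mulmx_block !mulmx1 !mul1mx !mulmx0 !add0r mulNmx mulmxN opprK.
    by rewrite mulmxN mul_scalar_mx mul_mx_scalar subrr.
  have := congr1 determinant E.
  rewrite det_mulmx det_lblock det_ublock !det1 !mulr1 !det_scalar det_mx11 expr1.
  by rewrite mulrC => ->; congr (_ * _); rewrite !mxE eqxx.
apply: (mulIf (expf_neq0 n d0)); rewrite -key -CG -dG mulrCA -det_mulmx.
by rewrite mulmxDl -mulmxA.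
Qed.

(** * Circulant determinants of order 8 *)

(** Conjugation by a unipotent block matrix makes the matrix block triangular. *)
Lemma det_block_sym (R : comNzRingType) n (P Q : 'M[R]_n) :
  \det (block_mx P Q Q P) = \det (P + Q) * \det (P - Q).
Proof.
have E: block_mx 1%:M 1%:M 0 1%:M *m block_mx P Q Q P *m block_mx 1%:M (- 1%:M) 0 1%:M
     = block_mx (P + Q) 0 Q (P - Q).
  rewrite !mulmx_block !mulmx1 !mul1mx !mulmx0 !mul0mx !addr0 !add0r !mulmxN !mulmx1.
  by rewrite [Q + P]addrC addNr [- Q + P]addrC.
by have := congr1 determinant E; rewrite !det_mulmx !det_ublock !det_lblock !det1 !mulr1 !mul1r.
Qed.

(** Subtraction in ['I_n.+1] is modular, so this is the matrix of convolution by [f] on the cyclic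
    group. *)
Definition circ (R : comNzRingType) n (f : 'I_n.+1 -> R) := \matrix_(i, j) f (i - j).

Lemma det_mx4 (R : comNzRingType) (M : nat -> nat -> R) :
  \det (\matrix_(i < 4, j < 4) M i j) =
    M 0 0 * (M 1 1 * (M 2 2 * M 3 3 - M 2 3 * M 3 2)
           - M 1 2 * (M 2 1 * M 3 3 - M 2 3 * M 3 1)
           + M 1 3 * (M 2 1 * M 3 2 - M 2 2 * M 3 1))
  - M 0 1 * (M 1 0 * (M 2 2 * M 3 3 - M 2 3 * M 3 2)
           - M 1 2 * (M 2 0 * M 3 3 - M 2 3 * M 3 0)
           + M 1 3 * (M 2 0 * M 3 2 - M 2 2 * M 3 0))
  + M 0 2 * (M 1 0 * (M 2 1 * M 3 3 - M 2 3 * M 3 1)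
           - M 1 1 * (M 2 0 * M 3 3 - M 2 3 * M 3 0)
           + M 1 3 * (M 2 0 * M 3 1 - M 2 1 * M 3 0))
  - M 0 3 * (M 1 0 * (M 2 1 * M 3 2 - M 2 2 * M 3 1)
           - M 1 1 * (M 2 0 * M 3 2 - M 2 2 * M 3 0)
           + M 1 2 * (M 2 0 * M 3 1 - M 2 1 * M 3 0)).
Proof.
rewrite !(expand_det_row _ ord0) !big_ord_recl !big_ord0 /cofactor.
rewrite !(expand_det_row _ ord0) !big_ord_recl !big_ord0 /cofactor.
rewrite !(expand_det_row _ ord0) !big_ord_recl !big_ord0 /cofactor !det_mx11 !mxE /=.
ring.
Qed.

(* The product of [a(w)] over the 8th roots of unity [w != 1]; the last factor is
   the norm of [a(zeta_8)], taken first down to [Z[i]]. *)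
Definition circ8_nontriv (R : comNzRingType) (a : nat -> R) :=
  (a 0 - a 1 + a 2 - a 3 + a 4 - a 5 + a 6 - a 7)
  * ((a 0 - a 2 + a 4 - a 6) ^+ 2 + (a 1 - a 3 + a 5 - a 7) ^+ 2)
  * (((a 0 - a 4) ^+ 2 - (a 2 - a 6) ^+ 2 + 2 * (a 1 - a 5) * (a 3 - a 7)) ^+ 2
     + (2 * (a 0 - a 4) * (a 2 - a 6) - (a 1 - a 5) ^+ 2 + (a 3 - a 7) ^+ 2) ^+ 2).

Lemma det_circ8 (R : comNzRingType) (a : nat -> R) :
  \det (circ (fun k : 'I_8 => a k)) =
  (a 0 + a 1 + a 2 + a 3 + a 4 + a 5 + a 6 + a 7) * circ8_nontriv a.
Proof.
(* Quarter blocks of the circulant; the offsets 8 and 4 keep the natural subtraction from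
   truncating. Then [P + Q] and [P - Q] correspond to the factors [x^4 - 1] and [x^4 + 1]. *)
pose P i j := a ((i + 8 - j) %% 8)%N; pose Q i j := a ((i + 4 - j) %% 8)%N.
transitivity (\det (block_mx (\matrix_(i < 4, j < 4) P i j) (\matrix_(i < 4, j < 4) Q i j)
                             (\matrix_(i < 4, j < 4) Q i j) (\matrix_(i < 4, j < 4) P i j))).
  congr (\det _); apply/matrixP=> i j; case: (@split_ordP 4 4 i) => i' ->; case: (@split_ordP 4 4 j) => j' ->;
    rewrite !mxE ?(unsplitK (inl _)) ?(unsplitK (inr _)) !mxE ?(unsplitK (inl _)) ?(unsplitK (inr _)) !mxE /P /Q /=; congr (a _);
    move: (ltn_ord i') (ltn_ord j'); rewrite /=; lia.
rewrite det_block_sym.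
have ->: (\matrix_(i < 4, j < 4) P i j) + (\matrix_(i < 4, j < 4) Q i j)
       = \matrix_(i < 4, j < 4) (P i j + Q i j) by apply/matrixP=> i j; rewrite !mxE.
have ->: (\matrix_(i < 4, j < 4) P i j) - (\matrix_(i < 4, j < 4) Q i j)
       = \matrix_(i < 4, j < 4) (P i j - Q i j) by apply/matrixP=> i j; rewrite !mxE.
rewrite (det_mx4 (fun i j => P i j + Q i j)) (det_mx4 (fun i j => P i j - Q i j)).
rewrite /P /Q /circ8_nontriv /=.
ring.
Qed.

Lemma sqr_eq_mod2 (x : int) : exists y : int, x ^+ 2 = x + 2 * y.
Proof.
have [y [->|->]] : exists y : int, x = 2 * y \/ x = 2 * y + 1.
- by exists (x %/ 2)%Z; lia.
- by exists (2 * y ^+ 2 - y); ring.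
- by exists (2 * y ^+ 2 + y); ring.
Qed.

Lemma odd_prod4 (a b c d : int) :
  ~~ (2 %| (2 * a + 1) * ((2 * b + 1) * (2 * c + 1) * (2 * d + 1)))%Z.
Proof.
have odd1 (x : int) : (2 %| `|(2 * x + 1)%R|)%N = false by lia.
by rewrite dvdzE !abszM !Euclid_dvdM // !odd1.
Qed.

(** Here [s0], [s1] stand for the sums of the even and odd coefficients, [d0 + d1 i] for the value
    at [i], and [r0 + r1 i] for the norm of the value at [zeta_8] down to [Z[i]]. Every factor has
    the parity of [s0 + s1]. If [s0], [s1] are both even, the powers of 2 are 2, 2, 4, 2; if both
    are odd, the first two factors give 8 and the others 2 each. *)
Lemma even_dvd32 (s0 s1 d0 d1 r0 r1 x y w : int) :
    d0 = s0 + 2 * x -> d1 = s1 + 2 * y -> r0 + r1 = s0 + s1 + 2 * w ->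
  let D := (s0 + s1) * ((s0 - s1) * (d0 ^+ 2 + d1 ^+ 2) * (r0 ^+ 2 + r1 ^+ 2)) in
  ~~ (2 %| D)%Z || ((2 ^+ 5 : int) %| D)%Z.
Proof.
move=> -> -> Er /=.
have [p Ep] := sqr_eq_mod2 r0; have [q Eq] := sqr_eq_mod2 r1.
have -> : r0 ^+ 2 + r1 ^+ 2 = s0 + s1 + 2 * (w + p + q) by rewrite Ep Eq; lia.
move: (w + p + q) => {Ep Eq Er r0 r1}z.
have [k [->|->]] : exists k : int, s0 = 2 * k \/ s0 = 2 * k + 1 by exists (s0 %/ 2)%Z; lia.
- have [l [->|->]] : exists k : int, s1 = 2 * k \/ s1 = 2 * k + 1 by exists (s1 %/ 2)%Z; lia.
  + apply/orP; right; apply/dvdzP.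
    by exists ((k + l) * (k - l) * ((k + x) ^+ 2 + (l + y) ^+ 2) * (k + l + z)); ring.
  + apply/orP; left.
    have := odd_prod4 (k + l) (k - l - 1)
      (2 * (k + x) ^+ 2 + 2 * (l + y) ^+ 2 + 2 * (l + y)) (k + l + z).
    by congr (~~ (_ %| _)%Z); ring.
- have [l [->|->]] : exists k : int, s1 = 2 * k \/ s1 = 2 * k + 1 by exists (s1 %/ 2)%Z; lia.
  + apply/orP; left.
    have := odd_prod4 (k + l) (k - l)
      (2 * (k + x) ^+ 2 + 2 * (k + x) + 2 * (l + y) ^+ 2) (k + l + z).
    by congr (~~ (_ %| _)%Z); ring.
  + apply/orP; right; apply/dvdzP.
    have [p1 Ep] := sqr_eq_mod2 k; have [q1 Eq] := sqr_eq_mod2 l.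
    exists ((k + p1 - l - q1) * (2 * (k + x) ^+ 2 + 2 * (k + x) + 2 * (l + y) ^+ 2 + 2 * (l + y) + 1)
       * (k + l + 1 + z)).
    (* [s0 + s1] and [s0 - s1] are then twice [k + l + 1] and [k - l], which have
       opposite parities: this gives the fifth factor 2. *)
    have E : 2 * (k + p1 - l - q1) = k ^+ 2 + k - (l ^+ 2 + l) by rewrite Ep Eq; ring.
    transitivity (2 * (k + p1 - l - q1) * (2 * (k + x) ^+ 2 + 2 * (k + x) + 2 * (l + y) ^+ 2 + 2 * (l + y) + 1)
       * (k + l + 1 + z) * 16); last by ring.
    by rewrite E; ring.
Qed.

Lemma circ8_even_dvd32 (a : nat -> int) :
  let D := \det (circ (fun k : 'I_8 => a k)) in
  ~~ (2 %| D)%Z || ((2 ^+ 5 : int) %| D)%Z.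
Proof.
rewrite /= det_circ8 /circ8_nontriv.
move: (a 0) (a 1) (a 2) (a 3) (a 4) (a 5) (a 6) (a 7) => a0 a1 a2 a3 a4 a5 a6 a7.
have [p0 E0] := sqr_eq_mod2 (a0 - a4); have [p1 E1] := sqr_eq_mod2 (a1 - a5).
have [p2 E2] := sqr_eq_mod2 (a2 - a6); have [p3 E3] := sqr_eq_mod2 (a3 - a7).
pose r0 := (a0 - a4) ^+ 2 - (a2 - a6) ^+ 2 + 2 * (a1 - a5) * (a3 - a7).
pose r1 := 2 * (a0 - a4) * (a2 - a6) - (a1 - a5) ^+ 2 + (a3 - a7) ^+ 2.
have Er : r0 + r1 = a0 + a2 + a4 + a6 + (a1 + a3 + a5 + a7) +
    2 * ((a1 - a5) * (a3 - a7) + (a0 - a4) * (a2 - a6) + p0 - p2 - p1 + p3 - a4 - a1 - a2 - a7).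
  by rewrite /r0 /r1 E0 E1 E2 E3; ring.
have Ed0 : a0 - a2 + a4 - a6 = a0 + a2 + a4 + a6 + 2 * (- a2 - a6) by ring.
have Ed1 : a1 - a3 + a5 - a7 = a1 + a3 + a5 + a7 + 2 * (- a3 - a7) by ring.
have := even_dvd32 Ed0 Ed1 Er; rewrite /r0 /r1 /=.
by congr (~~ (_ %| _)%Z || (_ %| _)%Z); ring.
Qed.

Lemma mul_circ (R : comNzRingType) n (f g : 'I_n.+1 -> R) :
  circ f *m circ g = circ (fun l => \sum_k f k * g (l - k)).
Proof.
apply/matrixP=> i j; rewrite !mxE.
rewrite (reindex_inj (inj_comp (addrI i) oppr_inj)) /=; apply: eq_bigr => k _; rewrite !mxE.
by rewrite opprB addrCA subrr addr0 addrAC.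
Qed.

Lemma circ_scalar (R : comNzRingType) n (a : R) :
  circ (fun l : 'I_n.+1 => a *+ (l == 0)) = a%:M.
Proof. by apply/matrixP=> i j; rewrite !mxE subr_eq0. Qed.

(* With [Sigma] the sum of all elements of [C_8], [f * e = v + t Sigma] says that
   [e] inverts [f] up to [v] at the nontrivial characters.  Replacing [f] by
   [f + m Sigma] only moves its value [s] at the trivial character. *)
Lemma circ8_shift (f e : nat -> int) (s v t c m : int) :
    (forall l : 'I_8, \sum_(k < 8) f k * e ((l - k)%R : 'I_8) = v *+ (l == 0) + t) ->
    \sum_(k < 8) f k = s -> \sum_(k < 8) e k = c -> circ8_nontriv f = v ->
  let h (k : 'I_8) := f k + m in
  let g (k : 'I_8) := (s + 8 * m) * e k - (t + m * c) in
  [/\ \det (circ h) = v * (s + 8 * m), circ h *m circ g = (v * (s + 8 * m))%:M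
    & \sum_k g k = s * c - 8 * t].
Proof.
move=> fe fs ec fv h g; split.
- rewrite (det_circ8 (fun k => f k + m)) -fv -fs !big_ord_recr big_ord0 /=.
  by rewrite /circ8_nontriv; ring.
- rewrite mul_circ -circ_scalar; apply/matrixP=> i j; rewrite !mxE /=.
  move: (i - j) => l.
  have eE: \sum_(k < 8) e ((l - k)%R : 'I_8) = c.
    by rewrite -ec [RHS](reindex_inj (inj_comp (addrI l) oppr_inj)).
  have hgE k : h k * g (l - k) = (s + 8 * m) * (f k * e ((l - k)%R : 'I_8))
      + (s + 8 * m) * m * e ((l - k)%R : 'I_8) - (t + m * c) * f k - (t + m * c) * m.
    by rewrite /h /g; ring.
  under eq_bigr => k _ do rewrite hgE.
  rewrite !big_split /= !sumrN -!mulr_sumr fe fs eE sumr_const card_ord.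
  by case: (l == 0); rewrite /=; ring.
- rewrite /g big_split /= sumrN -mulr_sumr ec sumr_const card_ord.
  ring.
Qed.

(** An odd square is 1 mod 8: with [q + p = q(q+1)/2], one has [g j ^+ 2 - 8 (q + p) = 1], and 8 is
    the sum of the [g k]. *)
Lemma bezout_of_odd_coef (g : 'I_8 -> int) (j : 'I_8) (q : int) :
  \sum_k g k = 8 -> g j = 2 * q + 1 -> exists n : 'I_8 -> int, \sum_k n k * g k = 1.
Proof.
move=> sg gj; have [p Ep] := sqr_eq_mod2 q.
exists (fun k => (g j) *+ (k == j) - (q + p)).
have E: 2 * (q + p) = q + q ^+ 2 by rewrite Ep; ring.
under eq_bigr => k _ do rewrite mulrBl.
rewrite big_split /= sumrN -mulr_sumr sg (bigD1 j) //= eqxx big1 ?addr0; last first.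
  by move=> k /negPf ->; rewrite mul0r.
rewrite mulr1n gj.
transitivity ((2 * q + 1) ^+ 2 - 4 * (2 * (q + p))); first by ring.
by rewrite E; ring.
Qed.

Ltac circ8_compute := first
  [ by case=> -[|[|[|[|[|[|[|[|//]]]]]]]] ?; rewrite !big_ord_recr big_ord0 /=
  | by rewrite !big_ord_recr big_ord0 | by [] | idtac ].

Lemma circ8_realize (A : int) :
    ~~ (2 %| A)%Z || ((2 ^+ 5 : int) %| A)%Z ->
  exists f g n : 'I_8 -> int,
    [/\ circ f *m circ g = A%:M, \det (circ f) = A & \sum_k n k * g k = 1].
Proof.
(* Each pair [f], [e] covers a whole progression [v (s + 8 m)]. The entries of [g] sum to [v]: if
   [v = 1], equal weights 1 suffice; if [v = 8], the parities of [s], [c], [t] make [g 0] odd. *)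
have real (f e : seq int) (s v t c : int) :
    (forall l : 'I_8, \sum_(k < 8) f`_k * e`_((l - k)%R : 'I_8) = v *+ (l == 0) + t) ->
    \sum_(k < 8) f`_k = s -> \sum_(k < 8) e`_k = c -> circ8_nontriv (nth 0 f) = v ->
    s * c - 8 * t = v ->
    v = 1 \/ (v = 8 /\ exists x y z, [/\ s = 2 * x, c = 2 * y & t = 2 * z + 1]) ->
    forall m, exists F g n : 'I_8 -> int,
    [/\ circ F *m circ g = (v * (s + 8 * m))%:M, \det (circ F) = v * (s + 8 * m) & \sum_k n k * g k = 1].
  move=> fe fs ec fv sv vP m.
  have [] := circ8_shift m fe fs ec fv; rewrite sv.
  set F := fun k : 'I_8 => _ + m; set g := fun k : 'I_8 => _ - _ => dF Fg sg.
  exists F, g.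
  have [n nP] : exists n : 'I_8 -> int, \sum_k n k * g k = 1.
    case: vP => [v1|[v8 [x [y [z [sx cy tz]]]]]].
      by exists (fun=> 1); under eq_bigr => k _ do rewrite mul1r; rewrite sg v1.
    apply: (@bezout_of_odd_coef g 0 ((x + 4 * m) * e`_0 - z - 1 - m * y)).
      by rewrite sg v8.
    by rewrite /g sx cy tz /=; ring.
  by exists n.
case/orP=> [A_odd|/dvdzP[b ->]].
  (* [1 + x + ... + x^(r-1)] with [r] odd is a unit at the nontrivial characters,
     since [r^2 = 1] mod 8. *)
  have [m [->|[->|[->|->]]]] : exists m : int, A = 1 * (1 + 8 * m) \/ A = 1 * (3 + 8 * m)
      \/ A = 1 * (5 + 8 * m) \/ A = 1 * (7 + 8 * m).
    by exists (A %/ 8)%Z; lia.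
  - apply: (real [:: 1; 0; 0; 0; 0; 0; 0; 0] [:: 1; 0; 0; 0; 0; 0; 0; 0] 1 1 0 1); circ8_compute; by left.
  - apply: (real [:: 1; 1; 1; 0; 0; 0; 0; 0] [:: 1; 0; 0; 1; 0; 0; 1; 0] 3 1 1 3); circ8_compute; by left.
  - apply: (real [:: 1; 1; 1; 1; 1; 0; 0; 0] [:: 1; 0; 1; 0; 1; 1; 0; 1] 5 1 3 5); circ8_compute; by left.
  - apply: (real [:: 1; 1; 1; 1; 1; 1; 1; 0] [:: 1; 0; 1; 1; 1; 1; 1; 1] 7 1 6 7); circ8_compute; by left.
(* [1 - x] and [1 + x + x^2 + x^4] have norm 8 over the nontrivial characters, the
   least possible for an even [A]. *)
have [m [->|->]] : exists m : int, b * 2 ^+ 5 = 8 * (0 + 8 * m) \/ b * 2 ^+ 5 = 8 * (4 + 8 * m).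
  by exists (b %/ 2)%Z; lia.
- apply: (real [:: 1; -1; 0; 0; 0; 0; 0; 0] [:: 0; -1; -2; -3; -4; -5; -6; -7] 0 8 (-1) (-28)); circ8_compute; by right; split=> //; exists 0, (-14), (-1).
- apply: (real [:: 1; 1; 1; 0; 1; 0; 0; 0] [:: 0; 1; -2; -1; 4; -3; 2; 3] 4 8 1 4); circ8_compute; by right; split=> //; exists 2, 2, 0.
Qed.

(** * Additive characters and the determinant of the affine group *)

Definition addchar (V : nmodType) (R : comNzRingType) (chi : V -> R) :=
  chi 0 = 1 /\ forall x y, chi (x + y) = chi x * chi y.

(** The determinant can be expanded in [Z[V]] before applying [chi], so one [c] serves all
    characters. Formally, the expressions [rep] contain the integers and are closed under sums and
    products, a product being a convolution. *)
Lemma det_addchar (V : finZmodType) (R : comNzRingType) n (f : 'I_n -> 'I_n -> V -> int) :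
  exists c : V -> int, forall chi : V -> R, addchar chi ->
    \det (\matrix_(i, j) \sum_x (f i j x)%:~R * chi x) = \sum_x (c x)%:~R * chi x.
Proof.
pose rep (E : (V -> R) -> R) :=
  exists c : V -> int, forall chi, addchar chi -> E chi = \sum_x (c x)%:~R * chi x.
have repC (a : int) : rep (fun=> a%:~R).
  exists (fun x => a *+ (x == 0)) => chi [chi0 _].
  rewrite (bigD1 0) //= eqxx chi0 mulr1 big1 ?addr0 // => x /negPf->.
  by rewrite mul0r.
have repD E1 E2 : rep E1 -> rep E2 -> rep (fun chi => E1 chi + E2 chi).
  move=> [c1 H1] [c2 H2]; exists (fun x => c1 x + c2 x) => chi chiP.
  by rewrite H1 // H2 // -big_split; apply: eq_bigr => x _; rewrite rmorphD mulrDl.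
have repM E1 E2 : rep E1 -> rep E2 -> rep (fun chi => E1 chi * E2 chi).
  move=> [c1 H1] [c2 H2]; exists (fun x => \sum_y c1 y * c2 (x - y)) => chi chiP.
  rewrite H1 // H2 // mulr_suml.
  under [RHS]eq_bigr => x _ do rewrite rmorph_sum mulr_suml.
  rewrite exchange_big /=; apply: eq_bigr => y _.
  rewrite mulr_sumr [RHS](reindex_inj (addrI y)) /=; apply: eq_bigr => x _.
  by rewrite addrAC subrr add0r chiP.2 rmorphM mulrACA.
have repS (I : finType) (E : I -> (V -> R) -> R) :
    (forall i, rep (E i)) -> rep (fun chi => \sum_i E i chi).
  move=> /fin_all_exists[c H]; exists (fun x => \sum_i c i x) => chi chiP.
  under eq_bigr => i _ do rewrite H //.
  by rewrite exchange_big; apply: eq_bigr => x _; rewrite rmorph_sum mulr_suml.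
have repP (I : finType) (E : I -> (V -> R) -> R) :
    (forall i, rep (E i)) -> rep (fun chi => \prod_i E i chi).
  move=> H; elim: (index_enum I) => [|i r [c IHr]].
    by case: (repC 1) => c Hc; exists c => chi chiP; rewrite big_nil -Hc.
  have [d Hd] := repM _ _ (H i) (ex_intro _ c IHr).
  by exists d => chi chiP; rewrite big_cons Hd.
suff [c Hc] : rep (fun chi => \det (\matrix_(i, j) \sum_x (f i j x)%:~R * chi x)) by exists c.
apply: (repS _ (fun (s : 'S_n) chi => (-1) ^+ s
  * \prod_i (\matrix_(i, j) \sum_x (f i j x)%:~R * chi x) i (s i))) => s.
apply: repM.
  by have [c Hc] := repC ((-1) ^+ s); exists c => chi chiP; rewrite -Hc // rmorphXn rmorphN1.
apply: repP => i; exists (f i (s i)) => chi chiP; by rewrite mxE.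
Qed.

(** Any nontrivial irreducible character of the abelian group [V] is linear, and its orthogonality
    to the trivial one is the vanishing of the sum. *)
Lemma exists_addchar (V : finZmodType) : (1 < #|V|)%N ->
  exists psi : V -> algC, addchar psi /\ \sum_x psi x = 0.
Proof.
move=> V_gt1; pose G := [set: V]%G.
have abG : abelian G by apply/centsP=> x _ y _; apply: addrC.
have cI : (1 < #|Iirr G|)%N by rewrite card_Iirr_abelian // cardsT.
have [i i0] : exists i : Iirr G, i != 0.
  have := cI; rewrite (cardD1 0) inE /= add1n ltnS => /card_gt0P[i].
  by rewrite !inE andbT => ?; exists i.
have lin : 'chi_i \is a linear_char by apply: (char_abelianP _ abG).
exists (fun x => 'chi_i x); split.
  split; first exact: (lin_char1 lin).
  by move=> x y; apply: (lin_charM lin); rewrite inE.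
have := cfdot_irr i 0; rewrite (negPf i0) irr0 cfdotE => /eqP.
rewrite mulf_eq0 invr_eq0 pnatr_eq0 cardsT (gtn_eqF (ltnW V_gt1)) /= => /eqP s0; rewrite -[RHS]s0.
apply: eq_big => [x|x _]; first by rewrite inE.
by rewrite cfun1E inE rmorph1 mulr1.
Qed.

Lemma sum_addchar (F : finFieldType) (R : comNzRingType) (psi : F -> R) (y : F) :
  addchar psi -> \sum_x psi x = 0 -> \sum_x psi (x * y) = #|F|%:R *+ (y == 0).
Proof.
move=> [psi0 _] s0; have [->|y0] := eqVneq.
  under eq_bigr => x _ do rewrite mulr0 psi0.
  by rewrite sumr_const.
by rewrite mulr0n -[RHS]s0 [RHS](reindex_inj (mulIf y0)).
Qed.

(** * Powers of a primitive root as coordinates on the multiplicative group *)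

Lemma prim_root_neq0 (F : fieldType) n (z : F) k : n.+1.-primitive_root z -> z ^+ k != 0.
Proof. by move=> zP; rewrite expf_neq0 // (prim_root_eq0 zP). Qed.

Lemma prim_exprB (F : fieldType) n (z : F) (i j : 'I_n.+1) :
  n.+1.-primitive_root z -> z ^+ (i - j)%R = z ^+ i / z ^+ j.
Proof.
move=> zP; apply: (mulIf (prim_root_neq0 j zP)); rewrite divfK ?(prim_root_neq0 _ zP) // -exprD.
apply/eqP; rewrite (eq_prim_root_expr zP) /=.
by rewrite modnDml addnAC modnDmr -addnA subnKC ?modnDr // ltnW.
Qed.

Lemma exists_prim_root (F : finFieldType) n : #|F| = n.+2 ->
  exists z : F, n.+1.-primitive_root z.
Proof.
move=> cF; have := @cyclic.has_prim_root F n.+1 (enum [pred x : F | x != 0]).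
have cF0 : #|[pred x : F | x != 0]| = n.+1.
  by have := cardC1 (0 : F); rewrite cF /= => <-; apply: eq_card => x; rewrite !inE.
rewrite enum_uniq -cardE cF0 leqnn => /(_ isT) H.
have /H/(_ isT isT)/hasP[z _ zP]: all n.+1.-unity_root (enum [pred x : F | x != 0]).
  apply/allP=> x; rewrite mem_enum inE => x0; apply/unity_rootP.
  by apply: (mulfI x0); rewrite mulr1 -exprS -cF expf_card.
by exists z.
Qed.

Lemma big_prim_root (F : finFieldType) n (z : F) (R : Type) (idx : R)
    (op : Monoid.com_law idx) (phi : F -> R) :
    #|F| = n.+2 -> n.+1.-primitive_root z ->
  \big[op/idx]_x phi x = op (phi 0) (\big[op/idx]_(i < n.+1) phi (z ^+ i)).
Proof.
move=> cF zP; rewrite (bigD1 0) //=; congr (op _ _).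
(* Discrete logarithm; the default 0 is taken only at [x = 0]. *)
pose log x : 'I_n.+1 := odflt 0 [pick i : 'I_n.+1 | z ^+ i == x].
have logK x : x != 0 -> z ^+ log x = x.
  move=> x0; have [|i xE] := prim_rootP zP (x := x).
    by apply: (mulfI x0); rewrite mulr1 -exprS -cF expf_card.
  by rewrite /log; case: pickP => [k /eqP //|/(_ i)]; rewrite xE eqxx.
rewrite (reindex (fun i : 'I_n.+1 => z ^+ i)); last first.
  exists log => [i _|x]; last by rewrite inE; apply: logK.
  apply/val_inj; have /eqP := logK _ (prim_root_neq0 i zP).
  by rewrite (eq_prim_root_expr zP) !modn_small // => /eqP.
by apply: eq_bigl => i; rewrite (prim_root_neq0 i zP).
Qed.

(** * Fourier factorization of the affine determinant *)

(* [(i, b)] stands for the affine map [x |-> z^i (x + b)], so that the quotient of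
   [p] by [q] is [(p.1 - q.1, z^q.1 (p.2 - q.2))]. *)
Definition affdet (F : finFieldType) n (z : F) (a : 'I_n.+1 -> F -> int) : int :=
  @fdet int ('I_n.+1 * F)%type (fun p q => a (p.1 - q.1) (z ^+ q.1 * (p.2 - q.2))).

(** The block [(i, j)] of the matrix in [affdet] is a convolution operator on [F]; the entry here is
    its eigenvalue at [chi]. *)
Definition fourier_mx (F : finFieldType) n (z : F) (a : 'I_n.+1 -> F -> int)
    (chi : F -> algC) : 'M[algC]_n.+1 :=
  \matrix_(i, j) \sum_x (a (i - j) (z ^+ j * x))%:~R * chi x.

(** The character matrix [W] intertwines the group matrix [K] with the block diagonal matrix of the
    [N y]: [K W = W N]. Orthogonality makes [W W'] the scalar [#|F|], so [\det W] cancels. *)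
Lemma affdet_prod (F : finFieldType) n (z : F) (a : 'I_n.+1 -> F -> int) (psi : F -> algC) :
    addchar psi -> \sum_x psi x = 0 ->
  (affdet z a)%:~R = \prod_y \det (fourier_mx z a (fun x => psi (- (x * y)))).
Proof.
move=> psiP psi_sum; have [psi0 psiD] := psiP.
pose K (p q : 'I_n.+1 * F) : algC := (a (p.1 - q.1) (z ^+ q.1 * (p.2 - q.2)))%:~R.
pose W (p q : 'I_n.+1 * F) : algC := (p.1 == q.1)%:R * psi (p.2 * q.2).
pose W' (p q : 'I_n.+1 * F) : algC := (p.1 == q.1)%:R * psi (- (p.2 * q.2)).
pose N y i j : algC := fourier_mx z a (fun x => psi (- (x * y))) i j.
have pair_sum (p q : 'I_n.+1) (E : F -> algC) (M : 'I_n.+1 * F -> algC) :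
   (forall r, M r = (p == r.1)%:R * E r.2) -> \sum_r M r = \sum_x E x.
  move=> ME; under eq_bigr => r _ do rewrite ME.
  rewrite -(pair_bigA _ (fun r x => (p == r)%:R * E x)) (bigD1 p) //=.
  rewrite [X in _ + X]big1 ?addr0 => [|r rp].
    by apply: eq_bigr => x _; rewrite eqxx mul1r.
  by apply: big1 => x _; rewrite eq_sym (negPf rp) mul0r.
have W_neq0 : fdet W != 0.
  suff: fdet W * fdet W' != 0 by rewrite mulf_eq0 negb_or => /andP[].
  rewrite -fdetM.
  have -> : fdet (fun p q => \sum_r W p r * W' r q) =
      fdet (fun p q : 'I_n.+1 * F => #|F|%:R *+ (p == q) : algC).
    apply: eq_fdet => -[i b] [j c].
    rewrite (pair_sum i i (fun x => (i == j)%:R * psi (x * (b - c)))) => [|[k x]].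
      rewrite -mulr_sumr sum_addchar // subr_eq0 xpair_eqE.
      by case: (i == j); rewrite ?mul1r ?mul0r.
    rewrite /W /W' /=; have [->|ik] := eqVneq i k; last by rewrite !mul0r.
    rewrite !mul1r mulrCA -psiD; congr (_ * psi _); ring.
  rewrite /fdet; set M := (X in \det X).
  have -> : M = #|F|%:R%:M.
    by apply/matrixP=> i j; rewrite !mxE (inj_eq enum_val_inj).
  rewrite det_scalar expf_neq0 // pnatr_eq0.
  by apply/eqP=> /card0_eq/(_ 0).
have -> : (affdet z a)%:~R = fdet K.
  rewrite /fdet -(det_map_mx intr) /=; congr (\det _).
  by apply/matrixP=> i j; rewrite !mxE.
have -> : \prod_y \det (fourier_mx z a (fun x => psi (- (x * y)))) =
   @fdet _ ('I_n.+1 * F)%type (fun p q => (p.2 == q.2)%:R * N p.2 p.1 q.1).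
  rewrite fdet_diag; apply: eq_bigr => y _; rewrite fdet_ord.
  by congr (\det _); apply/matrixP=> i j; rewrite [RHS]mxE.
apply: (mulIf W_neq0); rewrite [RHS]mulrC -!fdetM; apply: eq_fdet => -[i b] [j y].
rewrite (pair_sum j j (fun c => (a (i - j) (z ^+ j * (b - c)))%:~R * psi (c * y))); last first.
  move=> [k c]; rewrite /K /W /= eq_sym; have [->|_] := eqVneq j k; last by rewrite !mul0r mulr0.
  by rewrite !mul1r.
rewrite (pair_sum i i (fun w => psi (b * w) * ((w == y)%:R * N w i j))); last first.
  by move=> [k w]; rewrite /W /=; have [->|_] := eqVneq i k; rewrite ?mul1r ?mul0r.
rewrite [RHS](bigD1 y) //= eqxx mul1r [X in _ = _ + X]big1 ?addr0; last first.
  by move=> w /negPf->; rewrite mul0r mulr0.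
rewrite /N mxE mulr_sumr (reindex_inj (inj_comp (addrI b) oppr_inj)) /=.
apply: eq_bigr => x _; rewrite subKr [RHS]mulrCA -psiD; congr (_ * psi _); ring.
Qed.

Lemma det_fourier_trivial (F : finFieldType) n (z : F) (a : 'I_n.+1 -> F -> int) :
    n.+1.-primitive_root z ->
  \det (fourier_mx z a (fun=> 1)) = (\det (circ (fun k => \sum_x a k x)))%:~R.
Proof.
move=> zP; rewrite -(det_map_mx intr); congr (\det _).
apply/matrixP=> i j; rewrite !mxE rmorph_sum.
under eq_bigr => x _ do rewrite mulr1.
by rewrite [RHS](reindex_inj (mulfI (prim_root_neq0 j zP))).
Qed.

(** Substituting in the sum over [x] turns the dilation by [z ^+ l] into a simultaneous shift of
    rows and columns by [l]. *)
Lemma det_fourier_dilate (F : finFieldType) n (z : F) (a : 'I_n.+1 -> F -> int)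
    (chi : F -> algC) (l : 'I_n.+1) : n.+1.-primitive_root z ->
  \det (fourier_mx z a (fun x => chi (x * z ^+ l))) = \det (fourier_mx z a chi).
Proof.
move=> zP; pose N := fourier_mx z a chi.
transitivity (\det (\matrix_(i, j) N (i - l) (j - l))).
  congr (\det _); apply/matrixP=> i j; rewrite !mxE.
  have zl0 := prim_root_neq0 l zP.
  rewrite [RHS](reindex_inj (mulIf zl0)) /=; apply: eq_bigr => x _.
  rewrite (prim_exprB _ _ zP) opprB addrA subrK mulrCA [x * _]mulrC.
  by rewrite mulrCA [z ^+ l * _]mulrC mulrA; congr ((a _ _)%:~R * _); field.
rewrite (@det_reindex _ _ _ _ (fun i => i - l) id (fun i j => N i j)).
- by congr (\det _); apply/matrixP=> i j; rewrite mxE.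
- by exists (fun i => i + l) => i; rewrite ?addrK ?subrK.
- by exists id.
Qed.

Lemma affdet_factor (F : finFieldType) n (z : F) (a : 'I_n.+1 -> F -> int) (psi : F -> algC) :
    #|F| = n.+2 -> n.+1.-primitive_root z -> addchar psi -> \sum_x psi x = 0 ->
  (affdet z a)%:~R = (\det (circ (fun k => \sum_x a k x)))%:~R
    * \det (fourier_mx z a (fun x => psi (- x))) ^+ n.+1.
Proof.
move=> cF zP psiP psi_sum; rewrite (affdet_prod z a psiP psi_sum).
rewrite (big_prim_root _ _ cF zP) /=; congr (_ * _).
  rewrite -(det_fourier_trivial a zP); congr (\det _); apply/matrixP=> i j; rewrite !mxE.
  by apply: eq_bigr => x _; rewrite mulr0 oppr0 psiP.1.
under eq_bigr => l _ do rewrite (det_fourier_dilate a (fun x => psi (- x)) l zP).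
by rewrite prodr_const card_ord.
Qed.

Lemma det_fourier_congr (F : finFieldType) n (z : F) (a : 'I_n.+1 -> F -> int) (psi : F -> algC) :
    #|F| = n.+2 -> n.+1.-primitive_root z -> addchar psi -> \sum_x psi x = 0 ->
  exists c : int, \det (fourier_mx z a (fun x => psi (- x))) =
    (\det (circ (fun k => \sum_x a k x)) - #|F|%:Z * c)%:~R.
Proof.
move=> cF zP psiP psi_sum; have [psi0 psiD] := psiP.
have [c cP] := det_addchar algC (fun i j x => a (i - j) (z ^+ j * x)).
pose chi y x := psi (- (x * y)).
have chiP y : addchar (chi y).
  by split=> [|x x']; rewrite /chi ?mul0r ?oppr0 // mulrDl opprD psiD.
exists (c 1); set A := \det (circ _).
(* [T] is computed twice. Through [c] and orthogonality only [w = 1] survives. Through the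
   dilations, [y = 0] contributes [A], and all other [y] share one determinant, with weights [psi y]
   summing to -1. *)
pose T := \sum_y psi y * \det (fourier_mx z a (chi y)).
have TE : T = #|F|%:R * (c 1)%:~R.
  rewrite /T; under eq_bigr => y _ do rewrite (cP _ (chiP y)) mulr_sumr.
  rewrite exchange_big (bigD1 1) //= [X in _ + X]big1 ?addr0 => [|w w1].
    have <- : \sum_x psi (x * 0) = #|F|%:R by rewrite (sum_addchar 0 psiP psi_sum) eqxx.
    rewrite mulr_suml; apply: eq_bigr => y _; rewrite mulrCA mulrC /chi -psiD.
    by congr (psi _ * _); ring.
  have w10 : 1 - w != 0 by rewrite subr_eq0 eq_sym.
  transitivity ((c w)%:~R * \sum_y psi (y * (1 - w))).
    rewrite mulr_sumr; apply: eq_bigr => y _; rewrite mulrCA /chi -psiD.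
    by congr (_ * psi _); ring.
  by rewrite (sum_addchar _ psiP psi_sum) (negPf w10) mulr0.
have : T = A%:~R - \det (fourier_mx z a (fun x => psi (- x))).
  rewrite /T (big_prim_root _ _ cF zP) /= psi0 mul1r -(det_fourier_trivial a zP); congr (_ + _).
    by congr (\det _); apply/matrixP=> i j; rewrite !mxE; apply: eq_bigr => x _; rewrite /chi mulr0 oppr0 psi0.
  under eq_bigr => l _ do rewrite /chi (det_fourier_dilate a (fun x => psi (- x)) l zP).
  rewrite -mulr_suml -mulN1r; congr (_ * _); apply/eqP.
  by rewrite -addr_eq0 addrC -psi0 -(big_prim_root _ _ cF zP) psi_sum.
rewrite TE rmorphB rmorphM /= => E.
by rewrite [#|F|%:~R]/(#|F|%:R) E opprB addrC subrK.
Qed.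

(** * Realization of prescribed values *)

Lemma affdet_realize (F : finFieldType) n (z : F) (psi : F -> algC)
    (f g m : 'I_n.+1 -> int) (A k : int) :
    #|F| = n.+2 -> n.+1.-primitive_root z -> addchar psi -> \sum_x psi x = 0 ->
    circ f *m circ g = A%:M -> \det (circ f) = A -> \sum_i m i * g i = 1 -> A != 0 ->
  exists a : 'I_n.+1 -> F -> int, affdet z a = A * (A + #|F|%:Z * k) ^+ n.+1.
Proof.
move=> cF zP psiP psi_sum fg df mg A0; have [psi0 psiD] := psiP.
have zN l : z ^+ (- l : 'I_n.+1) = (z ^+ l)^-1 by rewrite -[- l]sub0r (prim_exprB _ _ zP) div1r.
(* [nu] has total weight 0 and weight [k * m i] at [z ^+ i]; it only affects the
   nontrivial characters, by the rank one matrix [u *m v] below. *)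
pose nu x : int := \sum_i k * m i * ((x == z ^+ i)%:R - (x == 0)%:R).
have nuE (R : comNzRingType) (chi : F -> R) :
    \sum_x (nu x)%:~R * chi x = \sum_i (k * m i)%:~R * (chi (z ^+ i) - chi 0).
  under eq_bigr => x _ do rewrite rmorph_sum mulr_suml.
  rewrite exchange_big; apply: eq_bigr => i _ /=.
  under eq_bigr => x _ do rewrite rmorphM /= -mulrA.
  rewrite -mulr_sumr; congr (_ * _).
  under eq_bigr => x _ do rewrite rmorphB /= mulrBl.
  have delta y : \sum_x ((x == y)%:R)%:~R * chi x = chi y.
    rewrite (bigD1 y) //= eqxx mul1r big1 ?addr0 // => x /negPf->.
    by rewrite mul0r.
  by rewrite big_split /= sumrN !delta.
(* At the entry [(i, j)] of the Fourier matrix, the substitution [x = z^(-i) - z^(-j) w] turns the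
   argument of [nu] into [w], while [psi (- x)] splits into a function of [i] times a function of
   [j]: hence rank one. *)
pose a (l : 'I_n.+1) x : int := f l *+ (x == 0) + nu (z ^+ (- l)%R - x).
exists a; apply: (@intr_inj algC); rewrite (affdet_factor a cF zP psiP psi_sum).
have -> : circ (fun l => \sum_x a l x) = circ f.
  apply/matrixP=> i j; rewrite !mxE; move: (i - j) => l; rewrite big_split /=.
  rewrite (bigD1 0) //= eqxx big1 ?addr0 => [|x /negPf-> //].
  rewrite (reindex_inj (inj_comp (addrI (z ^+ (- l)%R)) oppr_inj)) /=.
  under eq_bigr => x _ do rewrite subKr -[nu x]intz -[_%:~R]mulr1.
  rewrite (nuE int (fun=> 1)) big1 ?addr0 // => i' _.
  by rewrite subrr mulr0.
rewrite df rmorphM rmorphXn /=; congr (_ * _ ^+ _).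
pose u : 'cV[algC]_n.+1 := \col_i psi (- z ^+ (- i)%R).
pose v : 'rV[algC]_n.+1 := \row_j \sum_l (k * m l)%:~R * (psi (z ^+ (l - j)%R) - 1).
have -> : fourier_mx z a (fun x => psi (- x)) = map_mx intr (circ f) + u *m v.
  apply/matrixP=> i j; rewrite !mxE big_ord1 !mxE /a.
  under eq_bigr => x _ do rewrite rmorphD mulrDl.
  rewrite big_split; congr (_ + _).
    rewrite (bigD1 0) //= mulr0 eqxx oppr0 psi0 mulr1 big1 ?addr0 // => x x0.
    by rewrite mulf_eq0 (negPf (prim_root_neq0 j zP)) (negPf x0) mul0r.
  have zj0 := prim_root_neq0 (- j : 'I_n.+1) zP.
  have h_inj : injective (fun x => z ^+ (- i)%R - z ^+ (- j)%R * x).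
    by move=> x y /addrI/oppr_inj/(mulfI zj0).
  rewrite (reindex_inj h_inj).
  have key x : z ^+ (- (i - j))%R - z ^+ j * (z ^+ (- i)%R - z ^+ (- j)%R * x) = x.
    rewrite opprB (prim_exprB _ _ zP) !zN.
    by rewrite mulrBr mulVKf ?(prim_root_neq0 _ zP) // subKr.
  transitivity (\sum_x (nu x)%:~R * (psi (- z ^+ (- i)%R) * psi (z ^+ (- j)%R * x))).
    by apply: eq_bigr => x _; rewrite key -psiD opprB addrC.
  transitivity (psi (- z ^+ (- i)%R) * \sum_x (nu x)%:~R * psi (z ^+ (- j)%R * x)).
    by rewrite mulr_sumr; apply: eq_bigr => x _; rewrite mulrCA.
  rewrite (nuE _ (fun x => psi (z ^+ (- j)%R * x))); congr (_ * _); apply: eq_bigr => l _.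
  by rewrite mulr0 psi0 zN (prim_exprB _ _ zP) [z ^+ l / _]mulrC.
have A0C : A%:~R != 0 :> algC by rewrite intr_eq0.
rewrite (@det_add_rank1 _ _ _ (map_mx intr (circ g)) _ _ A%:~R) //; last 2 first.
- by rewrite -map_mxM fg map_scalar_mx.
- by rewrite det_map_mx df.
rewrite rmorphD; congr (_ + _).
have sum_z (w : F) : \sum_(i < n.+1) psi (z ^+ (- i)%R * w) = #|F|%:R *+ (w == 0) - 1.
  apply/eqP; rewrite -subr_eq0 opprB addrA subr_eq0; apply/eqP.
  rewrite -(sum_addchar w psiP psi_sum) (big_prim_root _ _ cF zP) /= mul0r psi0.
  by rewrite [in RHS](reindex_inj oppr_inj) addrC.
have zD (i j : 'I_n.+1) : z ^+ (i + j)%R = z ^+ i * z ^+ j.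
  by rewrite -[j in LHS]opprK (prim_exprB _ _ zP) zN invrK.
(* The coefficient of [g t] and [k * m l] in [v G u]. By orthogonality [S] is [#|F|] times the
   identity, so [v G u] collapses to [#|F| k] through the Bezout relation [mg]. *)
pose S (l t : 'I_n.+1) := \sum_(i < n.+1) (psi (z ^+ (l - (i + t))%R) - 1) * psi (- z ^+ (- i)%R).
have SE l t : S l t = #|F|%:R *+ (l == t).
  transitivity (\sum_(i < n.+1) (psi (z ^+ (- i)%R * (z ^+ (l - t)%R - 1)) - psi (z ^+ (- i)%R * - 1))).
    apply: eq_bigr => i _; rewrite mulrBl mul1r -psiD mulrBr mulrN mulr1 -zD.
    by rewrite [- i + _]addrC -addrA -opprD [t + i]addrC.
  rewrite sumrB !sum_z subr_eq0 oppr_eq0 oner_eq0.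
  rewrite mulr0n sub0r opprK subrK; congr (_ *+ nat_of_bool _).
  rewrite -[1](expr0 z) (eq_prim_root_expr zP) !modn_small //.
  by rewrite -subr_eq0.
transitivity (\sum_(t < n.+1) (g t)%:~R * \sum_(l < n.+1) (k * m l)%:~R * S l t); last first.
  transitivity (#|F|%:R * k%:~R * \sum_(t < n.+1) (m t * g t)%:~R : algC).
    rewrite mulr_sumr; apply: eq_bigr => t _; rewrite (bigD1 t) //= big1 ?addr0 => [|l lt].
      by rewrite SE eqxx mulr1n !rmorphM /=; ring.
    by rewrite SE (negPf lt) mulr0.
  by rewrite -rmorph_sum mg mulr1 rmorphM.
rewrite mxE.
transitivity (\sum_(i < n.+1) \sum_(t < n.+1) v 0 (i + t) * (g t)%:~R * u i 0).
  apply: eq_bigr => i _; rewrite mxE mulr_suml (reindex_inj (addrI i)).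
  by apply: eq_bigr => t _; rewrite !mxE addrAC subrr add0r.
rewrite exchange_big; apply: eq_bigr => t _.
transitivity ((g t)%:~R * \sum_(i < n.+1) v 0 (i + t) * u i 0).
  by rewrite mulr_sumr; apply: eq_bigr => i _; rewrite mulrAC mulrC.
congr (_ * _).
transitivity (\sum_(i < n.+1) \sum_(l < n.+1) (k * m l)%:~R *
    ((psi (z ^+ (l - (i + t))%R) - 1) * psi (- z ^+ (- i)%R))).
  apply: eq_bigr => i _; rewrite [v 0 _]mxE [u i 0]mxE mulr_suml.
  by apply: eq_bigr => l _; rewrite mulrA.
by rewrite exchange_big; apply: eq_bigr => l _; rewrite -mulr_sumr.
Qed.

(** * The affine group as a group of matrices *)

Definition aff_mx (F : finFieldType) (u b : F) : 'M[F]_2 :=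
  block_mx (u%:M : 'M_1) (b%:M : 'M_1) 0 1%:M.

Lemma aff_mxM (F : finFieldType) (u b v c : F) :
  aff_mx u b *m aff_mx v c = aff_mx (u * v) (u * c + b).
Proof.
rewrite /aff_mx (@mulmx_block _ 1 1 1 1 1 1) !mulmx0 !mul0mx !mulmx1 !addr0 add0r.
by rewrite -!scalar_mxM -raddfD.
Qed.

Lemma det_aff_mx (F : finFieldType) (u b : F) : \det (aff_mx u b) = u.
Proof. by rewrite /aff_mx (@det_ublock _ 1 1) !det_scalar expr1n mulr1. Qed.

Lemma aff_mx_dl (F : finFieldType) (u b : F) : aff_mx u b ord_max ord0 = 0.
Proof.
have -> : ord_max = rshift 1 (0 : 'I_1) :> 'I_2 by apply: val_inj.
have -> : ord0 = lshift 1 (0 : 'I_1) :> 'I_2 by apply: val_inj.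
by rewrite /aff_mx (@block_mxEdl _ 1 1 1 1) mxE.
Qed.

Lemma aff_mx_dr (F : finFieldType) (u b : F) : aff_mx u b ord_max ord_max = 1.
Proof.
have -> : ord_max = rshift 1 (0 : 'I_1) :> 'I_2 by apply: val_inj.
by rewrite /aff_mx (@block_mxEdr _ 1 1 1 1) mxE.
Qed.

Lemma aff_mx_eq (F : finFieldType) (M : 'M[F]_2) :
  M ord_max ord0 = 0 -> M ord_max ord_max = 1 -> M = aff_mx (M ord0 ord0) (M ord0 ord_max).
Proof.
have -> : ord_max = rshift 1 (0 : 'I_1) :> 'I_2 by apply: val_inj.
have -> : ord0 = lshift 1 (0 : 'I_1) :> 'I_2 by apply: val_inj.
move=> M10 M11; rewrite /aff_mx -[LHS](@submxK _ 1 1 1 1).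
congr (@block_mx _ 1 1 1 1 _ _ _ _); apply/matrixP=> i j;
  by rewrite !mxE !ord1 ?mulr1n.
Qed.

(** The translation part is written [z^i b], which puts quotients in the form used by [affdet].
    Injectivity of [phi] lets functions on pairs be carried back to the group. *)
Lemma groupdet_GA1 (F : finFieldType) n (z : F) :
    #|F| = n.+2 -> n.+1.-primitive_root z ->
  exists2 phi : 'I_n.+1 * F -> {'GL_2[F]}, injective phi &
    forall a, groupdet (GA1 F) a = affdet z (fun k x => a (phi (k, x))).
Proof.
move=> cF zP.
have aff_unit (p : 'I_n.+1 * F) : aff_mx (z ^+ p.1) (z ^+ p.1 * p.2) \is a GRing.unit.
  by rewrite -[_ \is a _]/(_ \in unitmx) unitmxE det_aff_mx unitfE (prim_root_neq0 _ zP).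
pose phi p : {'GL_2[F]} := FinRing.unit _ (aff_unit p).
have phi_inj : injective phi.
  move=> [i b] [j c] /(congr1 (@GLval 2 F)) /=; rewrite /aff_mx.
  move=> /(@eq_block_mx _ 1 1 1 1)[/matrixP/(_ 0 0) + /matrixP/(_ 0 0) + _ _].
  rewrite !mxE !mulr1n => /eqP zij.
  have {zij} -> : i = j.
    by move: zij; rewrite (eq_prim_root_expr zP) !modn_small // => /eqP/val_inj.
  by move=> /(mulfI (prim_root_neq0 j zP)) ->.
have phiM p q : (phi p * (phi q)^-1)%g = phi (p.1 - q.1, z ^+ q.1 * (p.2 - q.2)).
  apply/eqP; rewrite eq_sym -(inj_eq (mulIg (phi q))) mulgKV; apply/eqP/val_inj.
  transitivity (aff_mx (z ^+ (p.1 - q.1)%R) (z ^+ (p.1 - q.1)%R * (z ^+ q.1 * (p.2 - q.2)))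
    *m aff_mx (z ^+ q.1) (z ^+ q.1 * q.2)); first by [].
  rewrite aff_mxM (prim_exprB _ _ zP) mulrA divfK ?(prim_root_neq0 _ zP) // [X in aff_mx _ X]addrC.
  by rewrite [_ / _ * (_ * _)]mulrA divfK ?(prim_root_neq0 _ zP) // -mulrDr subrK.
have phi_GA1 p : phi p \in GA1 F.
  by rewrite inE /= aff_mx_dl aff_mx_dr !eqxx.
have phi_onto u : u \in GA1 F -> exists p, phi p = u.
  rewrite inE => /andP[/eqP u10 /eqP u11].
  have uE := aff_mx_eq u10 u11; set x := GLval u ord0 ord0 in uE.
  have x0 : x != 0.
    by have := GL_det u; rewrite -[X in X != 0]/(\det (GLval u)) uE det_aff_mx.
  have [|i xE] := prim_rootP zP (x := x).
    by apply: (mulfI x0); rewrite mulr1 -exprS -cF expf_card.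
  exists (i, GLval u ord0 ord_max / x); apply: val_inj.
  by rewrite /= -xE mulrC divfK // -uE.
have [|h hP] := @fin_all_exists _ _ (fun (i : 'I_#|GA1 F|) p => phi p = enum_val i).
  by move=> i; apply/phi_onto/enum_valP.
exists phi => // a.
rewrite /affdet (@fdetE _ _ _ h).
  congr (\det _); apply/matrixP=> i j; rewrite !mxE -!hP phiM; reflexivity.
exists (fun p => enum_rank_in (phi_GA1 p) (phi p)) => [i|p].
  by apply: enum_val_inj; rewrite enum_rankK_in // hP enum_valP.
by apply: phi_inj; rewrite hP enum_rankK_in.
Qed.

Theorem theorem5 (F : finFieldType) (hF : #|F| = 9%N) (D : int) :
  (exists a : {'GL_2[F]} -> int, groupdet (GA1 F) a = D) <->
  (exists A B : int,
      [/\ ~~ (2 %| A)%Z || ((2 ^+ 5 : int) %| A)%Z,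
          (B == A %[mod 9])%Z &
          D = A * B ^+ 8]).
Proof.
have [z zP] := exists_prim_root hF.
have [psi [psiP psi_sum]] : exists psi : F -> algC, addchar psi /\ \sum_x psi x = 0.
  by apply: exists_addchar; rewrite hF.
have [phi phi_inj phiP] := groupdet_GA1 hF zP.
split=> [[a <-]|[A [B [A_ok AB ->]]]].
  rewrite phiP; set b := fun k x => a (phi (k, x)).
  have [c cE] := det_fourier_congr b hF zP psiP psi_sum.
  (* [inord] extends the coefficients to [nat], as the explicit formulas of order 8 expect. *)
  pose s (k : nat) := \sum_x b (inord k) x.
  have sE : circ (fun k => \sum_x b k x) = circ (fun k : 'I_8 => s k).
    by apply/matrixP=> i j; rewrite !mxE /s inord_val.
  set A := \det (circ (fun k : 'I_8 => \sum_x b k x)) in cE; exists A, (A - 9 * c); split.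
  - rewrite /A sE; exact: circ8_even_dvd32.
  - by lia.
  apply: (@intr_inj algC); rewrite (affdet_factor b hF zP psiP psi_sum) cE.
  by rewrite hF -/A [RHS]rmorphM rmorphXn.
(* [b] is transported along a left inverse of [phi]; the default outside the image is harmless,
   since the determinant reads [a] only on [GA1 F]. *)
have extend (b : 'I_8 -> F -> int) : exists a, groupdet (GA1 F) a = affdet z b.
  pose inv u := odflt (0, 0) [pick p | phi p == u].
  have invK p : inv (phi p) = p.
    by rewrite /inv; case: pickP => [r /eqP/phi_inj //|/(_ p)]; rewrite eqxx.
  exists (fun u => b (inv u).1 (inv u).2); rewrite phiP; apply: eq_fdet => p q.
  by rewrite invK.
(* The rank one argument divides by [A]; for [A = 0] the zero function gives the value 0. *)
have [->|A0] := eqVneq A 0.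
  exists (fun=> 0); rewrite mul0r phiP /affdet /fdet.
  set M := \matrix_(i, j) _; have -> : M = 0%:M by apply/matrixP=> i j; rewrite !mxE mul0rn.
  by rewrite det_scalar expr0n card_prod card_ord hF.
have [f [g [m [fg df mg]]]] := circ8_realize A_ok.
have [k ->] : exists k, B = A + 9 * k by exists ((B - A) %/ 9)%Z; lia.
have [b bE] := affdet_realize k hF zP psiP psi_sum fg df mg A0.
by have [a aE] := extend b; exists a; rewrite aE bE hF.
Qed.
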